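(* For all $n,\ell,r\ge 2$, \(\alpha\bigl(J^{(r)}_{n,\ell}\bigr)=\binom nr-t_r(n,\ell-1)\).
   Context: Let $\mathbf{k}$ be a field of characteristic zero and $R_{n,r}=\mathbf{k}[y_E:E\in\binom{[n]}r]$. For a pair $\{a,b\}\subset[n]$, $u^{(r)}_{ab}=\prod_{E\in\binom{[n]}r,\ \{a,b\}\subset E}y_E$, and $J^{(r)}_{n,\ell}=\bigcap_{L\in\binom{[n]}{\ell}}(u^{(r)}_{ab}:\{a,b\}\subset L)\subset R_{n,r}$. $\alpha(\cdot)$ denotes the initial degree of a homogeneous ideal. $t_r(n,q)$ is the number of edges of the complete balanced $q$-partite $r$-graph on $n$ vertices, i.e. $\sum_{S\in\binom{[q]}r}\prod_{i\in S}n_i$ for balanced class sizes $n_1,\ldots,n_q$ (zero if $r>q$). *)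

(* Defs.v *)
From mathcomp Require Import all_boot all_order all_algebra.
From mathcomp Require Import mpoly.

Set Implicit Arguments.
Unset Strict Implicit.
Unset Printing Implicit Defensive.

Import GRing.Theory.
Local Open Scope ring_scope.

(* [n] is rendered as 'I_n, so that edge n r is the set of r-subsets of [n]. *)
Definition edge (n r : nat) : finType := {E : {set 'I_n} | #|E| == r}.

Notation edge_ring k n r := {mpoly k[#|edge n r|]}.

Definition y (k : fieldType) (n r : nat) (E : edge n r) : edge_ring k n r :=
  'X_(enum_rank E).

(* The pair {a, b} is given as the set P. *)
Definition u (k : fieldType) (n r : nat) (P : {set 'I_n}) : edge_ring k n r :=
  \prod_(E : edge n r | P \subset sval E) y k E.

Definition in_ideal (R : comNzRingType) (I : finType) (A : pred I)
    (g : I -> R) (p : R) : Prop :=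
  exists c : I -> R, p = \sum_(i | A i) c i * g i.

Definition J (k : fieldType) (n l r : nat) (p : edge_ring k n r) : Prop :=
  forall L : {set 'I_n}, #|L| = l ->
    in_ideal (fun P : {set 'I_n} => (#|P| == 2%N) && (P \subset L)) (u k r) p.

(* The initial degree of a homogeneous ideal I is the least d such that the
   graded piece I_d is nonzero; it is stated as a relation because it is
   undefined for the zero ideal. Note that 0 is d.-homog for every d. *)
Definition initial_degree (k : fieldType) (m : nat) (I : {mpoly k[m]} -> Prop)
    (d : nat) : Prop :=
  (exists p, [/\ I p, p != 0 & p \is d.-homog]) /\
  (forall e p, I p -> p != 0 -> p \is e.-homog -> (d <= e)%N).

Lemma initial_degree_uniq (k : fieldType) (m : nat) (I : {mpoly k[m]} -> Prop)
    (d e : nat) : initial_degree I d -> initial_degree I e -> d = e.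
Proof.
move=> [[p [Ip p0 hp]] mind] [[q [Iq q0 hq]] mine]; apply/eqP.
by rewrite eqn_leq (mind _ q) // (mine _ p).
Qed.

Definition class_size (n q i : nat) : nat := (n %/ q + (i < n %% q))%N.

Lemma sum_class_size (n q : nat) :
  (0 < q)%N -> (\sum_(i < q) class_size n q i = n)%N.
Proof.
move=> q0; rewrite big_split /= sum_nat_const card_ord.
rewrite -(big_mkord xpredT (fun i => nat_of_bool (i < n %% q)%N)).
rewrite (big_cat_nat (n := (n %% q)%N)) ?leq0n ?(ltnW (ltn_pmod n q0)) //=.
have -> : (\sum_(0 <= i < n %% q) (i < n %% q) = n %% q)%N.
  rewrite big_nat (eq_bigr (fun=> 1%N)) => [|i /andP[_ ->]//].
  by rewrite -big_nat sum_nat_const_nat subn0 muln1.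
rewrite big_nat big1 => [|i /andP[h _]]; last by rewrite ltnNge h.
by rewrite addn0 mulnC -divn_eq.
Qed.

Definition turan (r n q : nat) : nat :=
  (\sum_(S : {set 'I_q} | #|S| == r) \prod_(i in S) class_size n q i)%N.

(* Main.v *)
(* J is a monomial ideal.  A monomial m lies in J iff every l-subset of [n]
   contains a pair {a, b} all of whose r-edges E have y_E dividing m; so the
   edges not dividing m form an r-graph whose shadow graph has no clique on l
   vertices.  By Zykov's theorem such an r-graph has at most t_r(n, l-1) edges,
   which bounds deg m from below.  Equality is reached by the product of all
   y_E with E not rainbow for the balanced colouring of [n] by residues modulo
   l-1.  Zykov's bound is proved by induction on the clique number, bounding
   the r-cliques by those of the neighbourhood of a vertex of largest r-clique
   degree; what remains is that the elementary symmetric functions of q natural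
   numbers with given sum are largest when these are balanced. *)

Require Import Defs.
From mathcomp Require Import all_boot all_order all_algebra zify.
From mathcomp Require Import mpoly.

Set Implicit Arguments.
Unset Strict Implicit.
Unset Printing Implicit Defensive.

Import GRing.Theory.
Local Open Scope ring_scope.

(** * Elementary symmetric functions are largest on balanced sequences *)

(** The elementary symmetric function of degree [r], read off its generating polynomial so that
    recursion and permutation invariance come for free. *)
Definition elem_sym (r : nat) (s : seq nat) : nat :=
  ((\prod_(x <- s) (1 + x%:P * 'X) : {poly nat})`_r)%R.

Lemma elem_sym_nil r : elem_sym r [::] = (r == 0)%N.
Proof. by rewrite /elem_sym big_nil coef1; case: r. Qed.

Lemma elem_sym_consS r x s : elem_sym r.+1 (x :: s) = (elem_sym r.+1 s + x * elem_sym r s)%N.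
Proof. by rewrite /elem_sym big_cons mulrDl mul1r coefD -mulrA coefCM coefXM. Qed.

Lemma elem_sym0 s : elem_sym 0 s = 1%N.
Proof.
elim: s => [|x s ih]; first by rewrite elem_sym_nil.
by rewrite /elem_sym big_cons mulrDl mul1r coefD -mulrA coefCM coefXM mulr0 addr0.
Qed.

Lemma perm_elem_sym r s t : perm_eq s t -> elem_sym r s = elem_sym r t.
Proof. by move=> st; rewrite /elem_sym (perm_big _ st). Qed.

Local Open Scope nat_scope.

Definition balanced (n q : nat) : seq nat := mkseq (class_size n q) q.

Lemma turanE r n q : turan r n q = elem_sym r (balanced n q).
Proof.
rewrite /elem_sym /balanced big_map -(subn0 q) -/(index_iota 0 q) big_mkord subn0.
under eq_bigr do rewrite addrC.
rewrite bigA_distr coef_sum /turan [RHS](bigID (fun S : {set 'I_q} => #|S| == r)) /=.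
rewrite [X in (_ + X)%R]big1 ?addr0.
  apply: eq_bigr => S /eqP <-.
  rewrite -big_mkcond big_split /= prodr_const -rmorph_prod coefCM coefXn eqxx.
  by rewrite mulr1.
move=> S Sr; rewrite -big_mkcond big_split /= prodr_const -rmorph_prod coefCM.
by rewrite coefXn eq_sym (negPf Sr) mulr0.
Qed.

(** The two leading entries enter only through their sum, which is kept, and their product, which
    grows by [x - z - 1]. *)
Lemma elem_sym_transfer r x z s : z.+1 < x ->
  elem_sym r (x :: z :: s) <= elem_sym r (x.-1 :: z.+1 :: s).
Proof.
move=> zx; case: r => [|[|r]]; first by rewrite !elem_sym0.
  by rewrite !elem_sym_consS !elem_sym0; lia.
rewrite !elem_sym_consS; nia.
Qed.

Definition nearly_constant (m : nat) (s : seq nat) : bool :=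
  all (fun x => m <= x <= m.+1) s.

Lemma nearly_constant_count m s : nearly_constant m s ->
  sumn s = m * size s + count_mem m.+1 s /\
  count_mem m.+1 s + count_mem m s = size s.
Proof.
elim: s => [|x s ih] /=; first by rewrite muln0.
move=> /andP[mx /ih[-> sz]]; rewrite mulnS -sz; clear ih sz.
move: (count_mem m.+1 s) (count_mem m s) => a b.
have [->|xm] := eqVneq x m; first by rewrite (ltn_eqF (ltnSn m)) /=; lia.
have -> : x = m.+1 by lia.
by rewrite eqxx /=; lia.
Qed.

(** Length and sum determine how often [m] and [m.+1] occur. *)
Lemma nearly_constant_perm m s t : nearly_constant m s -> nearly_constant m t ->
  size s = size t -> sumn s = sumn t -> perm_eq s t.
Proof.
move=> ms mt sst sumst; apply/allP => /= x _; apply/eqP.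
have [] := nearly_constant_count ms; have [] := nearly_constant_count mt.
rewrite -sst -sumst => t1 t2 s1 s2.
have cm1 : count_mem m.+1 s = count_mem m.+1 t.
  by apply: (@addnI (m * size s)); rewrite -s1 -t1.
have [->|xm] := eqVneq x m.
  by apply: (@addnI (count_mem m.+1 s)); rewrite s2 cm1 t2.
have [->|xm1] := eqVneq x m.+1; first exact: cm1.
have noc w : nearly_constant m w -> count_mem x w = 0.
  move=> /allP mw; apply/eqP; rewrite -leqn0 leqNgt -has_count.
  by apply/hasPn => z /mw /=; apply: contraL => /eqP ->; lia.
by rewrite !noc.
Qed.

Lemma sumn_balanced n q : 0 < q -> sumn (balanced n q) = n.
Proof.
by move=> q0; rewrite -[RHS](sum_class_size n q0) sumnE big_map
  -(subn0 q) -/(index_iota 0 q) big_mkord subn0.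
Qed.

Lemma nearly_constant_balanced n q : nearly_constant (n %/ q) (balanced n q).
Proof.
by apply/allP => x /mapP[i _ ->]; rewrite /class_size; case: (i < _) => /=; lia.
Qed.

Lemma min_nearly_constant_perm m s : m \in s -> nearly_constant m s ->
  perm_eq s (balanced (sumn s) (size s)).
Proof.
move=> ms sm; have s0 : 0 < size s by case: (s) ms.
have [s1 s2] := nearly_constant_count sm.
have c0 : 0 < count_mem m s by rewrite -has_count has_pred1.
(* Since [m] occurs, [m.+1] occurs fewer than [size s] times, so that count is a genuine remainder;
   a sequence constantly [m.+1] would have another quotient. *)
have dm : sumn s %/ size s = m.
  by rewrite s1 divnMDl // divn_small ?addn0 // -s2 -[X in X < _]addn0 ltn_add2l.
apply: (nearly_constant_perm sm); rewrite ?size_mkseq ?sumn_balanced //.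
by rewrite -{1}dm nearly_constant_balanced.
Qed.

(* The sum of squares strictly decreases along unit transfers. *)
Lemma elem_sym_balanced r s : elem_sym r s <= elem_sym r (balanced (sumn s) (size s)).
Proof.
have [N] := ubnP (sumn [seq x ^ 2 | x <- s]).
elim: N s => // N ih s sN.
have [|s0] := posnP (size s); first by move/size0nil->.
have [m ms mmin] : exists2 m, m \in s & {in s, forall x, m <= x}.
  have /ex_minnP[m ms mmin] : exists m, m \in s.
    by case: (s) s0 => // x t _; exists x; rewrite mem_head.
  by exists m => // x /mmin.
have [sm|/allPn[x xs xm]] := boolP (nearly_constant m s).
  by rewrite (perm_elem_sym r (min_nearly_constant_perm ms sm)).
have mx : m.+1 < x by move: (mmin _ xs) xm; lia.
have st := perm_to_rem xs.
have mt : m \in rem x s.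
  by move: ms; rewrite (perm_mem st) inE; case: eqP => [|_ //]; lia.
have := perm_trans st (etrans (perm_cons x _ _) (perm_to_rem mt)).
set t := rem m _ => {}st.
rewrite (perm_elem_sym r st); apply: leq_trans (elem_sym_transfer r t mx) _.
(* The transfer keeps length and sum, hence the balanced target, and lowers the sum of squares by
   [2 * (x - m - 1)]. *)
have := ih (x.-1 :: m.+1 :: t).
have /= := perm_sumn st; have /= := perm_size st => -> ->.
have -> : x.-1 + (m.+1 + sumn t) = x + (m + sumn t) by lia.
apply; rewrite ltnS in sN; apply: leq_trans sN.
have /perm_sumn -> := perm_map (fun x => x ^ 2) st.
rewrite /= -!mulnn; nia.
Qed.

(** * Zykov's bound on the number of cliques *)

Definition clique (T : finType) (e : rel T) (A : {set T}) : bool :=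
  [forall x in A, forall z in A, (x != z) ==> e x z].

Definition cliques (T : finType) (e : rel T) (r : nat) (V : {set T}) :
    {set {set T}} :=
  [set A : {set T} | [&& A \subset V, #|A| == r & clique e A]].

Lemma cliqueP (T : finType) (e : rel T) (A : {set T}) :
  reflect {in A &, forall x z, x != z -> e x z} (clique e A).
Proof.
apply: (iffP forall_inP) => [h x z xA zA|h x xA].
  by move/forall_inP/(_ z zA)/implyP: (h x xA); apply.
by apply/forall_inP => z zA; apply/implyP; apply: h.
Qed.

Lemma sub_clique (T : finType) (e : rel T) (A B : {set T}) :
  A \subset B -> clique e B -> clique e A.
Proof.
by move=> /subsetP AB /cliqueP cB; apply/cliqueP => x z /AB + /AB; apply: cB.
Qed.

Lemma cliqueU1 (T : finType) (e : rel T) (v : T) (A : {set T}) :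
  ssrbool.symmetric e -> {in A, forall x, e v x} -> clique e A -> clique e (v |: A).
Proof.
move=> symm vA /cliqueP cA; apply/cliqueP => x z.
rewrite !inE => /predU1P[->|xA] /predU1P[->|zA]; rewrite ?eqxx // => xz.
- exact: vA.
- by rewrite symm vA.
- exact: cA.
Qed.

(** Deleting [v] is injective on the sets containing it and leaves a clique among its neighbours. *)
Lemma cliques_through_le (T : finType) (e : rel T) (r : nat) (V : {set T})
    (v : T) :
  #|[set A in cliques e r.+1 V | v \in A]| <=
  #|cliques e r [set x in V | e v x]|.
Proof.
rewrite -(card_in_imset (f := fun A : {set T} => A :\ v)); last first.
  move=> A B; rewrite !inE => /andP[_ vA] /andP[_ vB] /= AB.
  by rewrite -(setD1K vA) AB setD1K.
apply/subset_leq_card/subsetP => _ /imsetP[A + ->]; rewrite !inE.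
case/andP=> /and3P[AV /eqP rA cA] vA.
rewrite (sub_clique (subD1set A v) cA) andbT; apply/andP; split; last first.
  by move/eqP: (cardsD1 v A); rewrite vA rA add1n eqSS eq_sym.
apply/subsetP => x; rewrite !inE => /andP[xv xA].
by rewrite (subsetP AV) //=; apply: (cliqueP _ _ cA); rewrite // eq_sym.
Qed.

(* Erdős's degree argument: take v on the most r-cliques; every r-clique not
   inside the neighbourhood of v passes through one of its non-neighbours. *)
Lemma cliques_le_balanced (T : finType) (e : rel T) (q r : nat) (V : {set T}) :
  ssrbool.symmetric e -> irreflexive e ->
  (forall A : {set T}, A \subset V -> clique e A -> #|A| <= q) ->
  #|cliques e r V| <= elem_sym r (balanced #|V| q).
Proof.
move=> symm irr; elim: q r V => [|q ih] [|r] V Vq.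
1,3: rewrite elem_sym0 -(cards1 (@set0 T)); apply/subset_leq_card/subsetP => A;
  by rewrite !inE cards_eq0 => /and3P[_ ->].
  rewrite elem_sym_nil leqn0 cards_eq0 -subset0; apply/subsetP => A; rewrite !inE.
  by case/and3P=> /Vq AV /eqP rA /AV; rewrite rA.
have [->|[v0 v0V]] := set_0Vmem V.
  rewrite (_ : cliques _ _ _ = set0) ?cards0 //; apply/setP => A.
  rewrite !inE subset0; apply/and3P => -[/eqP->]; rewrite cards0 //.
pose d v := #|[set A in cliques e r.+1 V | v \in A]|.
case: (arg_maxnP d v0V) => v vV dmax; pose N := [set x in V | e v x].
have {}vV : v \in V := vV.
have NV : N \subset V by apply/subsetP => x; rewrite inE => /andP[].
(* A clique in [N] extends by [v], so the clique number drops by one and the induction hypothesis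
   applies to [N]. *)
have Nq (A : {set T}) : A \subset N -> clique e A -> #|A| <= q.
  move=> AN cA; have vA : v \notin A.
    by apply/negP => /(subsetP AN); rewrite inE irr andbF.
  have : #|v |: A| <= q.+1.
    apply: Vq; first by rewrite subUset sub1set vV (subset_trans AN).
    by apply: cliqueU1 => // x /(subsetP AN); rewrite inE => /andP[].
  by rewrite cardsU1 vA.
have cover : cliques e r.+1 V \subset cliques e r.+1 N :|:
    \bigcup_(w in V :\: N) [set A in cliques e r.+1 V | w \in A].
  apply/subsetP => A AV; rewrite in_setU.
  have [AN|/subsetPn[w wA wN]] := boolP (A \subset N).
    by move: AV; rewrite !inE AN => /and3P[_ -> ->].
  apply/orP; right; apply/bigcupP; exists w; last by rewrite inE AV.
  by rewrite in_setD wN; move: AV; rewrite inE => /and3P[/subsetP->].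
have bound : #|cliques e r.+1 V| <=
    #|cliques e r.+1 N| + #|V :\: N| * #|cliques e r N|.
  apply: leq_trans (subset_leq_card cover) _.
  apply: leq_trans (leq_card_setU _ _) _; rewrite leq_add2l.
  rewrite -sum_nat_const; elim/big_ind2: _ => [|A a B b Aa Bb|w].
  - by rewrite cards0.
  - by apply: leq_trans (leq_card_setU _ _) _; apply: leq_add.
  rewrite inE => /andP[_ wV].
  exact: leq_trans (dmax w wV) (cliques_through_le _ _ _ _).
apply: leq_trans bound _.
(* By the recursion of [elem_sym], [bound] and the induction hypothesis give the value at
   [#|V :\: N| :: balanced #|N| q], which has sum [#|V|] and length [q.+1]; balancing it
   concludes. *)
have := elem_sym_balanced r.+1 (#|V :\: N| :: balanced #|N| q).
rewrite elem_sym_consS /= size_mkseq.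
have -> : #|V :\: N| + sumn (balanced #|N| q) = #|V|.
  rewrite cardsD (setIidPr NV); case: (posnP q) => [q0|q0]; last first.
    by rewrite sumn_balanced // subnK // subset_leq_card.
  (* For [q = 0] the balanced sequence is empty, but so is [N]: one of its points would be a clique
     of size 1. *)
  rewrite q0 addn0; suff -> : #|N| = 0 by rewrite subn0.
  apply/eqP; rewrite cards_eq0 -subset0; apply/subsetP => x xN.
  suff : #|[set x]| <= q by rewrite cards1 q0.
  apply: Nq; rewrite ?sub1set //; apply/cliqueP => a b.
  by rewrite !inE => /eqP -> /eqP ->; rewrite eqxx.
by apply: leq_trans; rewrite leq_add ?leq_mul2l ?ih ?orbT.
Qed.

(** * Rainbow sets and residue classes *)

(** Functions choosing a point in each fibre over [S] are recovered from their images, because [c]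
    inverts them on [S] and they take the default [t0] elsewhere. *)
Lemma prod_fibers_le (I T : finType) (c : T -> I) (S : {set I}) (t0 : T) :
  \prod_(i in S) #|[set x | c x == i]| <=
  #|[set A : {set T} | (#|A| == #|S|) && (c @: A == S)]|.
Proof.
have -> : \prod_(i in S) #|[set x | c x == i]| =
    #|pfamily t0 (mem S) (fun i => [pred x | c x == i])|.
  under eq_bigr do rewrite -sum1dep_card.
  rewrite (big_distr_big_dep t0) -sum1_card.
  by apply: eq_bigr => f _; rewrite big1.
set F := pfamily _ _ _.
have FP (f : {ffun I -> T}) : f \in F ->
    {in S, forall i, c (f i) = i} /\ (forall i, i \notin S -> f i = t0).
  case/pfamilyP => supp fS; split=> [i /fS/eqP //|i iS].
  by apply/eqP; apply: contraNT iS => /(subsetP supp).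
rewrite -(card_in_imset (f := fun f : {ffun I -> T} => f @: S)); last first.
  move=> f g /FP[fc f0] /FP[gc g0] /= fg; apply/ffunP => i.
  have [iS|iS] := boolP (i \in S); last by rewrite f0 ?g0.
  have : f i \in g @: S by rewrite -fg imset_f.
  by case/imsetP => j jS fij; rewrite fij -[i](fc i) // fij gc.
apply/subset_leq_card/subsetP => _ /imsetP[f /FP[fc _] ->]; rewrite inE.
rewrite card_in_imset ?eqxx /=; last first.
  by move=> i j iS jS fij; rewrite -(fc i) // fij fc.
rewrite -imset_comp; apply/eqP/setP => i; apply/imsetP/idP => [[j jS ->]|iS].
  by rewrite /= fc.
by exists i; rewrite //= fc.
Qed.

Lemma card_rainbow_ge (I T : finType) (c : T -> I) (r : nat) (t0 : T) :
  \sum_(S : {set I} | #|S| == r) \prod_(i in S) #|[set x | c x == i]| <=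
  #|[set A : {set T} | (#|A| == r) && (#|c @: A| == r)]|.
Proof.
rewrite -sum1_card (partition_big (fun A : {set T} => c @: A)
  (fun S : {set I} => #|S| == r)) /= => [|A]; last by rewrite inE => /andP[].
apply: leq_sum => S /eqP Sr; apply: leq_trans (prod_fibers_le c S t0) _.
rewrite sum1dep_card; apply/subset_leq_card/subsetP => A; rewrite !inE Sr.
by case/andP=> -> /eqP ->; rewrite Sr !eqxx.
Qed.

Lemma card_residue_class (n q i : nat) : i < q ->
  #|[set x : 'I_n | x %% q == i]| = class_size n q i.
Proof.
move=> iq; have q0 : 0 < q by apply: leq_ltn_trans iq.
rewrite -sum1dep_card big_mkcond /=.
elim: n => [|n ih]; first by rewrite big_ord0 /class_size div0n mod0n.
rewrite big_ord_recr /= ih /class_size divnS // modnS.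
have := ltn_pmod n q0; case: (boolP (q %| n.+1)) => [dvd|_] lt.
  (* The new point [n] completes a round: all classes but the last already had the extra point, and
     now the quotient rises and the remainder resets. *)
  have -> : n %% q = q.-1.
    apply/eqP; rewrite -eqSS prednK // eqn_leq lt leqNgt.
    apply: contraL dvd => lt1.
    by rewrite /dvdn -addn1 -modnDml addn1 modn_small.
  have -> : (i < q.-1) = (q.-1 != i) by lia.
  by rewrite ltn0 addn0 -addnA addnC; congr (_ + _); case: eqP.
by rewrite add0n -addnA ltnS; case: ltngtP.
Qed.

(** * Monomials of [J] and the lower bound on degrees *)

Lemma card_edge n r : #|edge n r| = 'C(n, r).
Proof. by rewrite card_sig -[n in RHS]card_ord -card_draws cardsE. Qed.

Lemma val_edge_inj n r : injective (fun E : edge n r => val E).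
Proof. exact: val_inj. Qed.

Lemma prod_yE (k : fieldType) n r (Q : pred (edge n r)) :
  (\prod_(E | Q E) y k E = 'X_[\sum_(E | Q E) U_(enum_rank E)%MM])%R.
Proof. by rewrite mprodXE. Qed.

Lemma msupp_mul_u (k : fieldType) n r (P : {set 'I_n}) (c : edge_ring k n r) m
    (E : edge n r) :
  m \in msupp (c * u k r P)%R -> P \subset val E -> 0 < m (enum_rank E).
Proof.
rewrite /u prod_yE (perm_mem (msuppMX _ _)) => /mapP[m' _ ->] PE.
by rewrite mnmDE mnm_sumE (bigD1 E) //= mnm1E eqxx.
Qed.

(** A monomial of a sum occurs in some summand, here a multiple of the monomial [u k r P]. *)
Lemma J_msupp (k : fieldType) n l r (p : edge_ring k n r) m
    (L : {set 'I_n}) : J l p -> m \in msupp p -> #|L| = l ->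
  exists2 P : {set 'I_n}, (#|P| == 2) && (P \subset L) &
    forall E : edge n r, P \subset val E -> 0 < m (enum_rank E).
Proof.
move=> Jp mp Ll; have [c pE] := Jp L Ll.
have [P PL mP] : exists2 P : {set 'I_n}, (#|P| == 2) && (P \subset L) &
    m \in msupp (c P * u k r P)%R.
  apply/exists_inP; apply: contraLR mp; rewrite negb_exists_in.
  move=> /forall_inP h; rewrite -mcoeff_eq0 pE linear_sum /= big1 //.
  by move=> P PL; apply/eqP; rewrite mcoeff_eq0; apply: h.
by exists P => // E; apply: msupp_mul_u mP.
Qed.

Lemma initial_degree_J_ge (k : fieldType) (n l r e : nat)
    (p : edge_ring k n r) : 0 < l ->
  J l p -> p != 0%R -> p \is e.-homog -> 'C(n, r) - turan r n (l - 1) <= e.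
Proof.
move=> l0 Jp p0 /dhomogP pe.
have [m mp] : exists m, m \in msupp p.
  by move: p0; rewrite -msupp_eq0; case: (msupp p) => // m s _; exists m;
     rewrite mem_head.
(* The edges whose variables do not divide [m]; each other edge contributes at least 1 to the
   degree. *)
pose G := [set E : edge n r | m (enum_rank E) == 0].
have em : 'C(n, r) - #|G| <= e.
  rewrite -(pe m mp) /= mdegE -card_edge -[G]setCK -cardsCs.
  rewrite (reindex (@enum_rank (edge n r))) /=; last exact/onW_bij/enum_rank_bij.
  rewrite -sum1_card big_mkcond; apply: leq_sum => E _.
  by rewrite !inE; case: (m _).
apply: leq_trans em; apply: leq_sub2l; rewrite turanE.
(* The shadow graph of [G], in which every edge of [G] is an [r]-clique. *)
pose adj (a b : 'I_n) :=
  (a != b) && [exists E in G, [set a; b] \subset val E].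
have le_cl : #|G| <= #|cliques adj r [set: 'I_n]|.
  rewrite -(card_imset (mem G) (@val_edge_inj n r)).
  apply/subset_leq_card/subsetP => _ /imsetP[E EG ->].
  rewrite inE subsetT (valP E) /=; apply/cliqueP => a b aE bE ab.
  rewrite /adj ab; apply/exists_inP; exists E => //.
  by rewrite subUset !sub1set aE.
apply: leq_trans le_cl _; rewrite -[n in balanced n]card_ord -cardsT.
apply: cliques_le_balanced => [a b|a|A _ /cliqueP cA].
- by rewrite /adj eq_sym setUC.
- by rewrite /adj eqxx.
rewrite leqNgt; apply/negP => Al.
(* Among [l] vertices of a clique, [J_msupp] finds a pair whose edges all divide [m], while
   adjacency puts that pair in an edge of [G]. *)
have /card_geqP[s [us ss sA]] : l <= #|A| by lia.
have Ls : #|[set:: s]| = l by rewrite cardsE (card_uniqP us).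
have [P /andP[/cards2P[a [b [ab PE]]] PL] h] := J_msupp Jp mp Ls.
move: PL h; rewrite PE subUset !sub1set !inE => /andP[/sA aA /sA bA] h.
have /andP[_ /exists_inP[E]] := cA a b aA bA ab.
by rewrite inE => /eqP mE /h; rewrite mE.
Qed.

(** * The extremal monomial *)

(** By pigeonhole [L] contains two vertices of one colour; no edge through both is rainbow, so their
    [u] divides the product. *)
Lemma collision_J (k : fieldType) (n l r : nat) (I : finType) (c : 'I_n -> I) :
  #|I| < l ->
  J l (\prod_(E : edge n r | #|c @: val E| != r) y k E)%R.
Proof.
move=> Il L Ll.
have [a [b [aL bL ab cab]]] : exists a b, [/\ a \in L, b \in L, a != b & c a = c b].
  have /dinjectivePn[a aL [b]] : ~~ dinjectiveb c (mem L).
    apply: contraL Il => /dinjectiveP/card_in_imset cL.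
    by rewrite -leqNgt -Ll -cL max_card.
  by rewrite !inE => /andP[ba bL] cab; exists a, b; rewrite eq_sym.
pose P := [set a; b].
have PT (E : edge n r) : P \subset val E -> #|c @: val E| != r.
  rewrite subUset !sub1set => /andP[aE bE].
  apply/negP => /eqP cE; have /imset_injP inj : #|c @: val E| == #|val E|.
    by rewrite cE eq_sym (valP E).
  by move/eqP: ab; apply; apply: inj.
have PL : (#|P| == 2) && (P \subset L).
  by rewrite cards2 ab subUset !sub1set aL.
(* The cofactor of [u k r P] is the product over the non-rainbow edges not containing [P]. *)
exists (fun P' => if P' == P then
  (\prod_(E : edge n r | (#|c @: val E| != r) && ~~ (P \subset val E)) y k E)%R
  else 0%R).
rewrite (bigD1 P) //= eqxx [X in (_ + X)%R]big1 ?addr0; last first.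
  by move=> P' /andP[_ /negPf ->]; rewrite mul0r.
rewrite (bigID (fun E : edge n r => P \subset val E)) /= mulrC; congr (_ * _)%R.
by apply: eq_bigl => E; rewrite andb_idl //; apply: PT.
Qed.

Lemma prod_y_neq0 (k : fieldType) n r (Q : pred (edge n r)) :
  (\prod_(E | Q E) y k E != 0)%R.
Proof. by rewrite prod_yE -msupp_eq0 msuppX. Qed.

Lemma prod_y_homog (k : fieldType) n r (Q : pred (edge n r)) :
  (\prod_(E | Q E) y k E)%R \is #|Q|.-homog.
Proof.
apply/dhomogP => m; rewrite prod_yE msuppX inE => /eqP -> /=.
by rewrite mdeg_sum -[RHS]sum1_card; apply: eq_bigr => E _; rewrite mdeg1.
Qed.

Lemma card_collision_le n q r : 0 < n -> forall q0 : 0 < q,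
  #|[pred E : edge n r | #|(fun x : 'I_n => Ordinal (ltn_pmod x q0)) @: val E|
     != r]| <= 'C(n, r) - turan r n q.
Proof.
(* Writing [n] as a successor provides [ord0] as the default point for [card_rainbow_ge]. *)
case: n => // n _ q0; set c := fun x : 'I__ => _.
pose Q := [set E : edge n.+1 r | #|c @: val E| == r].
have tQ : turan r n.+1 q <= #|Q|.
  have -> : turan r n.+1 q = \sum_(S : {set 'I_q} | #|S| == r)
      \prod_(i in S) #|[set x | c x == i]|.
    apply: eq_bigr => S _; apply: eq_bigr => i _.
    by rewrite -card_residue_class.
  apply: leq_trans (card_rainbow_ge c r ord0) _.
  rewrite -(card_imset (mem Q) (@val_edge_inj n.+1 r)).
  apply/subset_leq_card/subsetP => A; rewrite inE => /andP[Ar cA].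
  by apply/imsetP; exists (exist _ A Ar : edge n.+1 r); rewrite ?inE.
apply: leq_trans (leq_sub2l _ tQ); rewrite -card_edge -[Q]setCK -cardsCs.
by apply/subset_leq_card/subsetP => E; rewrite !inE.
Qed.

Local Open Scope ring_scope.

Theorem theorem6p3 (k : fieldType) (char0 : [pchar k] =i pred0) (n l r : nat)
    (hn : (2 <= n)%N) (hl : (2 <= l)%N) (hr : (2 <= r)%N) :
  initial_degree (@J k n l r) ('C(n, r) - turan r n (l - 1))%N.
Proof.
have lo e (p : edge_ring k n r) : J l p -> p != 0 -> p \is e.-homog ->
    ('C(n, r) - turan r n (l - 1) <= e)%N.
  by apply: initial_degree_J_ge; apply: ltnW.
split=> //.
have q0 : (0 < l - 1)%N by rewrite subn_gt0.
pose c (x : 'I_n) := Ordinal (ltn_pmod x q0).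
pose Q := [pred E : edge n r | #|c @: val E| != r].
have Jp : J l (\prod_(E : edge n r | Q E) y k E).
  by apply: collision_J; rewrite card_ord subn1 prednK // ltnW.
(* Counting gives only one inequality; the other is the lower bound [lo] applied to this very
   monomial. *)
have dQ : #|Q| = ('C(n, r) - turan r n (l - 1))%N.
  apply/eqP; rewrite eqn_leq (card_collision_le r (ltnW hn) q0) /=.
  exact: lo Jp (prod_y_neq0 _ _) (prod_y_homog _ _).
exists (\prod_(E : edge n r | Q E) y k E).
by split=> //; [apply: prod_y_neq0 | rewrite -dQ; apply: prod_y_homog].
Qed.
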